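(* Let $\varepsilon \in \mathbb{R}^n$ and $j \in \{1,\dots,n\}$. If $x \in \mathcal{X}$ is strictly constraint MARO-efficient for $\varepsilon$ and $j$, then $x$ is strictly multi-scenario MARO-efficient for the preorder $\leqq^{l}$.
   Context: Setting (multicriteria adjustable robust optimization, MARO): $\mathcal{X} \subset \mathbb{R}^{n_x}$ and $\mathcal{U} \subset \mathbb{R}^{n_u}$ are compact sets; for each $x \in \mathcal{X}$, $u \in \mathcal{U}$, $\mathcal{Y}(x,u) \subset \mathbb{R}^{n_y}$ is a compact set; $f = (f_1,\dots,f_n)^T$ with each $f_i(x,u,y)$ a continuous real-valued function. The formal problem is $\min_{x \in \mathcal{X}} \max_{u \in \mathcal{U}} \min_{y \in \mathcal{Y}(x,u)} f(x,u,y)$. Here $\max$ and $\min$ of real-valued expressions denote optimal values (in the extended reals); minimization over an empty set has value $+\infty$ and maximization over an empty set has value $-\infty$. Efficient set of the inner stage: for vectors $a,b\in\mathbb{R}^n$ write $a \le b$ if $a_i \le b_i$ for all $i$ and $a \ne b$. For fixed $x,u$, $$\mathcal{Y}(x,u)_E := \{ y \in \mathcal{Y}(x,u) : \nexists\, y' \in \mathcal{Y}(x,u) \text{ with } f(x,u,y') \le f(x,u,y)\},$$ and $f(x,u,\mathcal{Y}(x,u)_E) := \{f(x,u,y) : y \in \mathcal{Y}(x,u)_E\} \subset \mathbb{R}^n$. Set relation: for $A,B \subset \mathbb{R}^n$, $A \leqq^{l} B$ means $B \subset A + \{z \in \mathbb{R}^n : z_i \ge 0 \ \forall i\}$. Strict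 multi-scenario MARO-efficiency with respect to a set relation $\leqq^*$: $x \in \mathcal{X}$ has this property if there is no $x' \in \mathcal{X} \setminus \{x\}$ such that $f(x',u,\mathcal{Y}(x',u)_E) \leqq^* f(x,u,\mathcal{Y}(x,u)_E)$ for all $u \in \mathcal{U}$. Strict constraint MARO-efficiency: for $\varepsilon \in \mathbb{R}^n$ and $j \in \{1,\dots,n\}$ let $$f_{\varepsilon,j}(x) := \max_{u \in \mathcal{U}} \ \min \{ f_j(x,u,y) : y \in \mathcal{Y}(x,u),\ f_i(x,u,y) \le \varepsilon_i \ \forall i \ne j \}.$$ A point $x \in \mathcal{X}$ is strictly constraint MARO-efficient for $\varepsilon$ and $j$ if there is no $x' \in \mathcal{X} \setminus \{x\}$ with $f_{\varepsilon,j}(x') \le f_{\varepsilon,j}(x)$. *)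

(* Defs.v *)
From mathcomp Require Import all_boot all_order all_algebra.
From mathcomp Require Import all_classical all_reals all_analysis.
Import Order.TTheory GRing.Theory Num.Theory.
Import numFieldNormedType.Exports.

Set Implicit Arguments.
Unset Strict Implicit.
Unset Printing Implicit Defensive.

Local Open Scope classical_set_scope.
Local Open Scope ring_scope.

(* Vectors of R^n are row vectors 'rV[R]_n, whose topology is the product
   topology.  The objective f and the inner feasible set Y are total functions;
   only their values at x \in X, u \in U, y \in Y x u matter. *)

Definition feasible_graph (R : realType) (nx nu ny : nat)
    (X : set 'rV[R]_nx) (U : set 'rV[R]_nu)
    (Y : 'rV[R]_nx -> 'rV[R]_nu -> set 'rV[R]_ny) :
    set ('rV[R]_nx * 'rV[R]_nu * 'rV[R]_ny) :=
  [set p | [/\ X p.1.1, U p.1.2 & Y p.1.1 p.1.2 p.2]].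

Definition vec_dominates (R : realType) (n : nat) (a b : 'rV[R]_n) : Prop :=
  (forall i : 'I_n, a 0 i <= b 0 i) /\ a <> b.

Definition nonneg_orthant (R : realType) (n : nat) : set 'rV[R]_n :=
  [set z | forall i : 'I_n, 0 <= z 0 i].

Definition set_leql (R : realType) (n : nat) (A B : set 'rV[R]_n) : Prop :=
  B `<=` [set a + z | a in A & z in @nonneg_orthant R n].

Definition efficient_set (R : realType) (nx nu ny n : nat)
    (Y : 'rV[R]_nx -> 'rV[R]_nu -> set 'rV[R]_ny)
    (f : 'rV[R]_nx -> 'rV[R]_nu -> 'rV[R]_ny -> 'rV[R]_n)
    (x : 'rV[R]_nx) (u : 'rV[R]_nu) : set 'rV[R]_ny :=
  [set y | Y x u y /\
    ~ exists2 y', Y x u y' & vec_dominates (f x u y') (f x u y)].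

Definition strict_multiscenario_MARO_efficient
    (R : realType) (nx nu ny n : nat)
    (X : set 'rV[R]_nx) (U : set 'rV[R]_nu)
    (Y : 'rV[R]_nx -> 'rV[R]_nu -> set 'rV[R]_ny)
    (f : 'rV[R]_nx -> 'rV[R]_nu -> 'rV[R]_ny -> 'rV[R]_n)
    (rel_set : set 'rV[R]_n -> set 'rV[R]_n -> Prop) (x : 'rV[R]_nx) : Prop :=
  X x /\
  ~ exists2 x', (X `\ x) x' &
      forall u, U u ->
        rel_set (f x' u @` efficient_set Y f x' u)
                (f x u @` efficient_set Y f x u).

(* Optimal values are extended reals: ereal_sup set0 = -oo and
   ereal_inf set0 = +oo. *)
Definition constraint_value (R : realType) (nx nu ny n : nat)
    (U : set 'rV[R]_nu)
    (Y : 'rV[R]_nx -> 'rV[R]_nu -> set 'rV[R]_ny)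
    (f : 'rV[R]_nx -> 'rV[R]_nu -> 'rV[R]_ny -> 'rV[R]_n)
    (eps : 'rV[R]_n) (j : 'I_n) (x : 'rV[R]_nx) : \bar R :=
  ereal_sup
    [set ereal_inf
       [set (f x u y 0 j)%:E | y in
          [set y | Y x u y /\
             forall i : 'I_n, i != j -> f x u y 0 i <= eps 0 i]] | u in U].

Definition strict_constraint_MARO_efficient
    (R : realType) (nx nu ny n : nat)
    (X : set 'rV[R]_nx) (U : set 'rV[R]_nu)
    (Y : 'rV[R]_nx -> 'rV[R]_nu -> set 'rV[R]_ny)
    (f : 'rV[R]_nx -> 'rV[R]_nu -> 'rV[R]_ny -> 'rV[R]_n)
    (eps : 'rV[R]_n) (j : 'I_n) (x : 'rV[R]_nx) : Prop :=
  X x /\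
  ~ exists2 x', (X `\ x) x' &
      (constraint_value U Y f eps j x' <= constraint_value U Y f eps j x)%E.

(* Main.v *)
Require Import Defs.
From mathcomp Require Import all_boot all_order all_algebra.
From mathcomp Require Import all_classical all_reals all_analysis.
Import Order.TTheory GRing.Theory Num.Theory.
Import numFieldNormedType.Exports.

(** The contrapositive is proved: a competitor x' that is at least as good as x
in the lower set relation, scenario by scenario, also has a constraint value
not exceeding that of x.  Fix a scenario u and some y feasible for x.  By
compactness y lies above an efficient y1 ([efficient_below]); the set relation
only speaks of efficient images, which is why this detour is needed, and it
puts f(x,u,y1) above f(x',u,y') for some y' feasible for x'.  Hence every
outcome of x is componentwise above an outcome of x'.  Going down
componentwise keeps the constraints f_i <= eps_i and does not increase f_j, so
the inner minima, and then their maximum over the scenarios, are ordered the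
same way ([constraint_value_le]). *)

Local Open Scope classical_set_scope.
Local Open Scope ring_scope.

Set Implicit Arguments.
Unset Strict Implicit.
Unset Printing Implicit Defensive.

Lemma within_continuous_slice (S T V : topologicalType) (D : set (S * T))
    (s : S) (A : set T) (g : S * T -> V) :
  (forall t, A t -> D (s, t)) ->
  {within D, continuous g} -> {within A, continuous (fun t => g (s, t))}.
Proof.
move=> AD /subspace_continuousP cg; apply/subspace_continuousP => t At.
apply: (@cvg_comp _ _ _ (fun t => (s, t)) g _ _ _ _ (cg _ (AD _ At))) => B.
have cst : (s, t') @[t' --> t] --> (s, t) by apply: cvg_pair; [exact: cvg_cst|].
move=> /= /cst; rewrite !near_simpl => Bt.
by apply: filterS Bt => t' + At'; apply; exact: AD.
Qed.

Lemma within_continuous_sum (R : realType) (T : topologicalType) (A : set T)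
    (I : finType) (g : I -> T -> R) :
  (forall i, {within A, continuous g i}) ->
  {within A, continuous (fun t => \sum_i g i t)}.
Proof.
move=> cg; apply: (@continuous_big _ _ +%R) => [p|i _]; last exact: cg.
exact: add_continuous.
Qed.

(** Continuity within A makes the sublevel set closed in A only, hence the trace
on A of a closed set; this avoids requiring A itself to be closed. *)
Lemma compact_sublevel (R : realType) (T : topologicalType) (A : set T)
    (I : Type) (g : I -> T -> R) (c : I -> R) :
  compact A -> (forall i, {within A, continuous g i}) ->
  compact (A `&` [set t | forall i, g i t <= c i]).
Proof.
move=> cA cg.
pose C : set (subspace A) := \bigcap_(i in [set: I]) g i @^-1` [set r | r <= c i].
have clC : closed C.
  apply: closed_bigI => i _.
  have /continuous_closedP := cg i.
  by apply; exact: closed_le.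
have /closed_subspaceP[V clV VA] := clC.
have -> : A `&` [set t | forall i, g i t <= c i] = A `&` V.
  rewrite [RHS]setIC VA setIC; congr (_ `&` _).
  by apply/seteqP; split=> t /= h i; [move=> _; exact: h|exact: h].
exact: compact_closedI.
Qed.

(** External stability of the efficient set: minimizing the sum of the
objectives over the part of A that lies componentwise below t0 yields an
efficient point, since any point dominating the minimizer would stay in that
part and have a strictly smaller sum. *)
Lemma efficient_below (R : realType) (T : topologicalType) (n : nat)
    (A : set T) (g : T -> 'rV[R]_n) (t0 : T) :
  compact A -> (forall i, {within A, continuous (fun t => g t 0 i)}) -> A t0 ->
  exists t, [/\ A t, forall i, g t 0 i <= g t0 0 i &
    ~ exists2 t', A t' & vec_dominates (g t') (g t)].
Proof.
move=> cA cg At0.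
pose K := A `&` [set t | forall i, g t 0 i <= g t0 0 i].
have cK : compact K by apply: (compact_sublevel (g := fun i t => g t 0 i)).
have K0 : K !=set0 by exists t0; split.
have cs : {within K, continuous (fun t => \sum_i g t 0 i)}.
  apply: within_continuous_sum => i.
  by apply: continuous_subspaceW (cg i) => ? [].
have [t /set_mem[At tt0] tmin] := compact_EVT_min K0 cK cs.
exists t; split=> // -[t' At' [t't neq]].
have Kt' : K t' by split=> // i; exact: le_trans (t't i) (tt0 i).
apply: neq; apply/rowP => i; apply/eqP; rewrite eq_le t't /=.
(* Were coordinate i strictly smaller at t', so would be the whole sum, against
   the choice of t. *)
have := tmin t' (mem_set Kt'); rewrite (bigD1 i)//= [leRHS](bigD1 i)//=.
have : \sum_(k | k != i) g t' 0 k <= \sum_(k | k != i) g t 0 k.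
  by apply: ler_sum.
by move=> h1 h2; rewrite leNgt; apply/negP => h3;
  have := ltr_leD h3 h1; rewrite ltNge h2.
Qed.

(** Componentwise descent from an outcome of x to an outcome of x' preserves
feasibility for the eps-constraints, so each infimum defining the value at x
is over numbers bounded below by elements of the matching set at x'. *)
Lemma constraint_value_le (R : realType) (nx nu ny n : nat)
    (U : set 'rV[R]_nu) (Y : 'rV[R]_nx -> 'rV[R]_nu -> set 'rV[R]_ny)
    (f : 'rV[R]_nx -> 'rV[R]_nu -> 'rV[R]_ny -> 'rV[R]_n)
    (eps : 'rV[R]_n) (j : 'I_n) (x x' : 'rV[R]_nx) :
  (forall u, U u -> forall y, Y x u y ->
    exists2 y', Y x' u y' & forall i, f x' u y' 0 i <= f x u y 0 i) ->
  (constraint_value U Y f eps j x' <= constraint_value U Y f eps j x)%E.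
Proof.
move=> below; apply: ge_ereal_sup => _ [u Uu <-].
apply: ereal_sup_ge; eexists; first by exists u.
apply: le_ereal_inf_tmp => _ [y [Yy yeps] <-].
have [y' Yy' y'y] := below u Uu y Yy.
apply: ereal_inf_le; exists (f x' u y' 0 j)%:E; last by rewrite lee_fin.
by exists y' => //; split=> // i ij; exact: le_trans (y'y i) (yeps i ij).
Qed.

Unset Implicit Arguments.

Theorem theorem21 (R : realType) (nx nu ny n : nat)
    (X : set 'rV[R]_nx) (U : set 'rV[R]_nu)
    (Y : 'rV[R]_nx -> 'rV[R]_nu -> set 'rV[R]_ny)
    (f : 'rV[R]_nx -> 'rV[R]_nu -> 'rV[R]_ny -> 'rV[R]_n)
    (hX : compact X) (hU : compact U)
    (hY : forall x u, X x -> U u -> compact (Y x u))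
    (hf : forall i : 'I_n,
       {within feasible_graph X U Y,
         continuous (fun p : 'rV[R]_nx * 'rV[R]_nu * 'rV[R]_ny =>
                       f p.1.1 p.1.2 p.2 0 i)})
    (eps : 'rV[R]_n) (j : 'I_n) (x : 'rV[R]_nx) :
  strict_constraint_MARO_efficient X U Y f eps j x ->
  strict_multiscenario_MARO_efficient X U Y f (@set_leql R n) x.
Proof.
move=> [Xx xopt]; split=> // -[x' x'X rel]; apply: xopt; exists x' => //.
apply: constraint_value_le => u Uu y Yy.
have cf i : {within Y x u, continuous (fun y => f x u y 0 i)}.
  by apply: (within_continuous_slice (s := (x, u)) _ (hf i)) => y' Yy'; split.
have [y1 [Yy1 y1y y1eff]] := efficient_below (hY x u Xx Uu) cf Yy.
have [] := rel u Uu (f x u y1); first by exists y1.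
move=> _ [y' [Yy' _] <-] [z z0 fy1].
exists y' => // i; apply: le_trans (y1y i).
by rewrite -fy1 mxE lerDl; exact: z0.
Qed.
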